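(* Let $N\ge 1$ be an integer, let $\lambda>0$ and $\sigma>0$ be real numbers, and let $\hat V_0,\dots,\hat V_{N-1}\in\mathbb{C}$ be the measured (gridded) visibilities, with dirty image $I^D=(I^D_0,\dots,I^D_{N-1})\in\mathbb{R}^N$. Put $a=N\lambda/\sigma^2$, and let $f_a^{-1}:(0,\infty)\to(0,\infty)$ be the inverse of the function $f_a(x)=xe^{ax}$ on $(0,\infty)$. Then there is exactly one real vector $I=(I_0,\dots,I_{N-1})\in\mathbb{R}^N$ which is a fixed point of the maximum entropy iteration, i.e. which satisfies, for all $\ell\in\{0,\dots,N-1\}$, $$I_\ell=\exp\left\{-1+\lambda\sum_{k=0}^{N-1}\frac{\mathrm{Re}\left(\left(\hat V_k-V^{\mathrm{model}}_k(I)\right)e^{i2\pi k\ell/N}\right)}{\sigma^2}\right\}.$$ All its entries are positive, and it is given pixel by pixel by $$I_\ell=f_a^{-1}\left(\exp\left\{\frac{N\lambda}{\sigma^2}I^D_\ell-1\right\}\right),\qquad \ell=0,\dots,N-1.$$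
   Context: For a real image $I=(I_0,\dots,I_{N-1})$, the model visibilities are its discrete Fourier transform $$V^{\mathrm{model}}_k(I)=\sum_{\ell=0}^{N-1}I_\ell e^{-i2\pi k\ell/N},\qquad k=0,\dots,N-1.$$ The dirty image is the inverse discrete Fourier transform of the gridded visibilities, $$I^D_\ell=\frac1N\sum_{k=0}^{N-1}\mathrm{Re}\left(\hat V_k e^{i2\pi k\ell/N}\right),\qquad \ell=0,\dots,N-1$$ (the real part is automatic when the visibilities are Hermitian symmetric). The noise variance $\sigma^2$ is the same for all visibilities, the weighting is uniform, and visibilities are given on the full regular grid $\{0,\dots,N-1\}$. The number $\lambda$ is a given Lagrange multiplier. The displayed fixed point system is the stationarity condition for maximizing $-\sum_\ell I_\ell\log I_\ell-\frac{\lambda}{2}\sum_{k}\frac{1}{\sigma^2}\left|\hat V_k-V^{\mathrm{model}}_k(I)\right|^2$ over images $I$. *)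

(* Defs.v *)
From HB Require Import structures.
From mathcomp Require Import all_boot all_order all_algebra.
From mathcomp Require Import complex.
From mathcomp Require Import all_classical all_reals all_analysis.

Set Implicit Arguments.
Unset Strict Implicit.
Unset Printing Implicit Defensive.

Import Order.TTheory GRing.Theory Num.Theory.
Import numFieldNormedType.Exports.

Local Open Scope classical_set_scope.
Local Open Scope ring_scope.
Local Open Scope complex_scope.

Definition cexp (R : realType) (z : R[i]) : R[i] :=
  (expR (complex.Re z))%:C * (cos (complex.Im z) +i* sin (complex.Im z)).

Definition phase (R : realType) (N : nat) (k l : 'I_N) : R :=
  2 * pi * k%:R * l%:R / N%:R.

Definition Vmodel (R : realType) (N : nat) (I : 'rV[R]_N) (k : 'I_N) : R[i] :=
  \sum_(l < N) (I 0 l)%:C * cexp (- ('i%C * (phase R k l)%:C)).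

Definition dirty_image (R : realType) (N : nat) (Vhat : 'rV[R[i]]_N) :
    'rV[R]_N :=
  \row_(l < N) (N%:R^-1 *
    \sum_(k < N) complex.Re (Vhat 0 k * cexp ('i%C * (phase R k l)%:C))).

Definition mem_fixed_point (R : realType) (N : nat) (lambda sigma : R)
    (Vhat : 'rV[R[i]]_N) (I : 'rV[R]_N) : Prop :=
  forall l : 'I_N,
    I 0 l = expR (- 1 + lambda *
      \sum_(k < N)
        complex.Re ((Vhat 0 k - Vmodel I k) * cexp ('i%C * (phase R k l)%:C))
          / sigma ^+ 2).

Definition fa (R : realType) (a x : R) : R := x * expR (a * x).

(* [pinv A f] is the inverse of the restriction of f to A on the image f @` A;
   by [fa_bij] this image is the whole of ]0, +oo[ when 0 < a, so that
   [fa_inv a] is the genuine inverse there. *)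
Definition fa_inv (R : realType) (a : R) : R -> R :=
  pinv (`]0, +oo[%classic : set R) (fa a).

Lemma fa_bij (R : realType) (a : R) :
  0 < a -> set_bij (`]0, +oo[%classic : set R) `]0, +oo[%classic (fa a).
Proof.
move=> a0; split.
- move=> x /=; rewrite !in_itv/= !andbT => x0.
  by rewrite /fa mulr_gt0 ?expR_gt0.
- have mono (x y : R) : 0 < x -> x < y -> fa a x < fa a y.
    move=> x0 xy; rewrite /fa; apply: ltr_pM => //.
    + exact: ltW.
    + by rewrite ltr_expR ltr_pM2l.
  move=> x y; rewrite !inE/= !in_itv/= !andbT => x0 y0 fxy.
  have [xy|xy|//] := ltgtP x y.
  + by have := mono _ _ x0 xy; rewrite fxy ltxx.
  + by have := mono _ _ y0 xy; rewrite fxy ltxx.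
- move=> y /=; rewrite in_itv/= andbT => y0.
  have cf : {within `[0, y], continuous (fa a)}.
    apply: continuous_subspaceT => x; rewrite /fa.
    apply: cvgM; first exact: cvg_id.
    apply: continuous_comp; last exact: continuous_expR.
    by apply: cvgM; [exact: cvg_cst | exact: cvg_id].
  have f0 : fa a 0 = 0 by rewrite /fa mul0r.
  have yf : y <= fa a y.
    by rewrite /fa ler_peMr ?(ltW y0)// -expR0 ler_expR mulr_ge0 ?ltW.
  have [|c] := IVT (ltW y0) cf (v := y).
  + by rewrite f0 ge_min (ltW y0)/= le_max yf orbT.
  + rewrite in_itv/= => /andP[c0 _] fc; exists c => //.
    rewrite /= in_itv/= andbT lt_neqAle c0 andbT.
    by apply/eqP => cE; move: y0; rewrite -fc -cE f0 ltxx.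
Qed.

Lemma fa_invP (R : realType) (a y : R) : 0 < a -> 0 < y ->
  0 < fa_inv a y /\ fa a (fa_inv a y) = y.
Proof.
move=> a0 y0; have [_ _ fsurj] := fa_bij a0.
have yin : y \in (`]0, +oo[%classic : set R) by rewrite inE/= in_itv/= y0.
split; last exact: (surjpK _ fsurj yin).
have [h _ _] := bijpinv_bij (fun=> point) (fa_bij a0).
by have := h y; rewrite /= !in_itv/= !andbT; apply.
Qed.

(* Main.v *)
(** On the full grid the discrete Fourier transform is inverted exactly:
    [\sum_k Re (V^model_k(I) e^{i 2 pi k l / N}) = N I_l] by orthogonality of the
    characters. The exponent at pixel [l] is therefore [a I^D_l - 1 - a I_l],
    so the system decouples into the scalar equations
    [f_a(I_l) = exp(a I^D_l - 1)], and [f_a] is a bijection of [(0, +oo)]. *)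

Require Import Defs.
From HB Require Import structures.
From mathcomp Require Import all_boot all_order all_algebra.
From mathcomp Require Import complex ring.
From mathcomp Require Import all_classical all_reals all_analysis.

Import Order.TTheory GRing.Theory Num.Theory.

Local Open Scope ring_scope.

(** Each product [2 * sin (theta / 2) * cos (k * theta)] is the difference of the sines of
    [(k + 1/2) * theta] and [(k - 1/2) * theta], so the sum telescopes. *)
Lemma sum_cos_telescope (R : realType) (theta : R) (n : nat) :
  2 * sin (theta / 2) * (\sum_(k < n) cos (k%:R * theta)) =
  sin (n%:R * theta - theta / 2) + sin (theta / 2).
Proof.
elim: n => [|n IHn].
  by rewrite big_ord0 mulr0 mul0r sub0r sinN addNr.
rewrite big_ord_recr /= mulrDr IHn.
have -> : n.+1%:R * theta - theta / 2 = n%:R * theta + theta / 2.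
  by rewrite -natr1; field.
by rewrite sinB sinD; ring.
Qed.

Lemma sum_cos_roots_of_unity (R : realType) (N j : nat) :
  (0 < j < N)%N -> \sum_(k < N) cos (k%:R * (2 * pi * j%:R / N%:R)) = 0 :> R.
Proof.
move=> /andP[j0 jN]; set theta := 2 * pi * j%:R / N%:R.
have N0 : 0 < N%:R :> R by rewrite ltr0n (ltn_trans j0).
have halfE : theta / 2 = pi * (j%:R / N%:R).
  by rewrite /theta; field; rewrite gt_eqF.
have half_neq0 : sin (theta / 2) != 0.
  (* Since [0 < j < N], the half angle [pi * j / N] lies strictly between [0] and [pi]. *)
  rewrite gt_eqF // sin_gt0_pi // halfE.
  rewrite mulr_gt0 ?pi_gt0 ?divr_gt0 ?(ltr0n _ j) //=.
  by rewrite gtr_pMr ?pi_gt0 // ltr_pdivrMr // mul1r ltr_nat.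
have := sum_cos_telescope R theta N.
(* [N * theta] is [j] full turns, so the two sines left by telescoping cancel. *)
have -> : N%:R * theta - theta / 2 = - (theta / 2) + pi *+ 2 *+ j.
  by rewrite -[_ *+ j]mulr_natr -[pi *+ 2]mulr_natr /theta; field; rewrite gt_eqF.
rewrite (periodicn (@sinD2pi R)) sinN addNr => /eqP.
by rewrite !mulf_eq0 pnatr_eq0 (negPf half_neq0) => /eqP.
Qed.

Lemma sum_cos_phase (R : realType) (N : nat) (l m : 'I_N) :
  \sum_(k < N) cos (phase R k l - phase R k m) = N%:R * (m == l)%:R.
Proof.
have [->|ml] := eqVneq m l.
  under eq_bigr do rewrite subrr cos0.
  by rewrite sumr_const card_ord mulr1.
rewrite mulr0.
(* Cosine is even, so the indices may be swapped; [m < l] makes [l - m] a true difference in [nat],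
   strictly between [0] and [N]. *)
wlog lt_ml : l m ml / (m < l)%N => [IH|].
  have /orP[|lm] : (m < l)%N || (l < m)%N by rewrite -neq_ltn.
    exact: IH.
  under eq_bigr do rewrite -cosN opprB.
  by apply: IH; rewrite // eq_sym.
rewrite -[RHS](@sum_cos_roots_of_unity R N (l - m)).
  by apply: eq_bigr => k _; congr cos; rewrite /phase natrB ?(ltnW lt_ml) //; ring.
by rewrite subn_gt0 lt_ml (leq_ltn_trans (leq_subr _ _)).
Qed.

Lemma cexpi (R : realType) (t : R) :
  cexp ('i%C * (t%:C)%C) = (cos t +i* sin t)%C.
Proof.
rewrite /cexp /=; simpc.
by rewrite /= ?mul0r ?mul1r ?subr0 ?add0r ?addr0 expR0 !mul1r.
Qed.

(** The image is real, so each pixel contributes only the real part of a unit exponential;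
    orthogonality is thus needed for cosines alone. *)
Lemma Re_Vmodel_cexp (R : realType) (N : nat) (I : 'rV[R]_N) (k l : 'I_N) :
  complex.Re (Vmodel I k * cexp ('i%C * ((phase R k l)%:C)%C)) =
  \sum_(m < N) I 0 m * cos (phase R k l - phase R k m).
Proof.
rewrite /Vmodel mulr_suml raddf_sum; apply: eq_bigr => m _.
rewrite -(mulrN 'i%C) -(rmorphN (real_complex R)) !cexpi; simpc => /=.
by rewrite cosN sinN cosB; ring.
Qed.

Lemma sum_Re_Vmodel_cexp (R : realType) (N : nat) (I : 'rV[R]_N) (l : 'I_N) :
  \sum_(k < N) complex.Re (Vmodel I k * cexp ('i%C * ((phase R k l)%:C)%C)) =
  N%:R * I 0 l.
Proof.
under eq_bigr do rewrite Re_Vmodel_cexp.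
rewrite exchange_big /=.
under eq_bigr do rewrite -mulr_sumr sum_cos_phase.
rewrite (bigD1 l) //= eqxx mulr1 big1 ?addr0 1?mulrC // => m /negPf ->.
by rewrite !mulr0.
Qed.

Lemma mem_fixed_pointE (R : realType) (N : nat) (lambda sigma : R)
    (Vhat : 'rV[R[i]%C]_N) (I : 'rV[R]_N) :
  let a := N%:R * lambda / sigma ^+ 2 in
  mem_fixed_point lambda sigma Vhat I <->
  forall l, fa a (I 0 l) = expR (a * dirty_image Vhat 0 l - 1).
Proof.
move=> a.
have exponentE l : - 1 + lambda * \sum_(k < N) complex.Re
      ((Vhat 0 k - Vmodel I k) * cexp ('i%C * ((phase R k l)%:C)%C)) / sigma ^+ 2
    = (a * dirty_image Vhat 0 l - 1) - a * I 0 l.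
  (* The existence of a pixel [l] forces [N] to be nonzero, which lets the [N] in [a] cancel the
     [1/N] of the dirty image. *)
  have N0 : N%:R != 0 :> R by rewrite pnatr_eq0 -lt0n (leq_ltn_trans _ (ltn_ord l)).
  under eq_bigr do rewrite mulrBl raddfB.
  rewrite -mulr_suml sumrB /= sum_Re_Vmodel_cexp /dirty_image mxE.
  by rewrite /a; set s := \sum_(k < N) _; set t := (sigma ^+ 2)^-1; field.
split=> fixI l; have := fixI l; rewrite /fa exponentE (expRB _ (a * I 0 l)) => Il.
  by rewrite [X in X * _]Il divfK // gt_eqF // expR_gt0.
by rewrite -Il mulfK // gt_eqF // expR_gt0.
Qed.

Theorem mainTheorem1 (R : realType) (N : nat) (hN : (1 <= N)%N)
    (lambda sigma : R) (hlambda : 0 < lambda) (hsigma : 0 < sigma)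
    (Vhat : 'rV[R[i]%C]_N) :
  let a := N%:R * lambda / sigma ^+ 2 in
  exists I : 'rV[R]_N,
    [/\ unique (mem_fixed_point lambda sigma Vhat) I,
        (forall l : 'I_N, 0 < I 0 l)
      & (forall l : 'I_N,
           I 0 l = fa_inv a
             (expR (N%:R * lambda / sigma ^+ 2 * dirty_image Vhat 0 l - 1)))].
Proof.
move=> a.
have a0 : 0 < a by rewrite divr_gt0 ?exprn_gt0 // mulr_gt0 // ltr0n.
pose y l := expR (a * dirty_image Vhat 0 l - 1).
have invP l := fa_invP a0 (expR_gt0 (a * dirty_image Vhat 0 l - 1)).
exists (\row_l fa_inv a (y l)); split=> [|l|l]; last 2 first.
- by rewrite mxE; have [] := invP l.
- by rewrite mxE.
split=> [|J fixJ].
  by apply/mem_fixed_pointE => l; rewrite mxE; have [] := invP l.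
apply/rowP => l; rewrite mxE.
have [inv_gt0 invE] := invP l.
have [_ fa_inj _] := fa_bij a0.
apply: fa_inj.
- by rewrite inE /= in_itv /= inv_gt0.
(* Any fixed point is entrywise an exponential, hence positive: it lies where [fa a] is
   injective. *)
- by rewrite inE /= in_itv /= fixJ expR_gt0.
- by rewrite invE; move/mem_fixed_pointE: fixJ => ->.
Qed.
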